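(* Let $f(q)=\sum_{n=0}^\infty q^n a_n$ be an entire slice regular function with order $\rho$ and type $\sigma$. Then $$\rho=\limsup_{n\to\infty}\frac{n\log n}{\log\left(\frac{1}{|a_n|}\right)},$$ and, when $0<\rho<\infty$, $$(\sigma e\rho)^{1/\rho}=\limsup_{n\to\infty}\left(n^{1/\rho}\sqrt[n]{|a_n|}\right).$$
   Context: $\mathbb{H}$ is the skew field of quaternions, $\mathbb{S}=\{I\in\mathbb{H}: I^2=-1\}$, $\mathbb{C}_I=\mathbb{R}+I\mathbb{R}$ for $I\in\mathbb{S}$. A real differentiable function $f:U\to\mathbb{H}$ on an open set $U\subseteq\mathbb{H}$ is slice regular if for every $I\in\mathbb{S}$ its restriction $f_I$ to $U\cap\mathbb{C}_I$ satisfies $\frac12\left(\frac{\partial}{\partial x}+I\frac{\partial}{\partial y}\right)f_I(x+Iy)=0$. It is entire if $U=\mathbb{H}$; entire slice regular functions are exactly the everywhere convergent power series $\sum_{n\ge0}q^n a_n$, $a_n\in\mathbb{H}$. Let $M_f(r)=\max_{|q|=r}|f(q)|$. The order $\rho$ of $f$ is the greatest lower bound of the numbers $k>0$ such that $M_f(r)<e^{r^k}$ for all sufficiently large $r$; equivalently $\rho=\limsup_{r\to\infty}\frac{\log\log M_f(r)}{\log r}$ ($\rho=\infty$ if there is no such $k$). If $f$ has order $\rho<\infty$, its type $\sigma$ is the greatest lower bound of the numbers $A>0$ such that $M_f(r)<e^{Ar^\rho}$ for all sufficiently large $r$; equivalently $\sigma=\limsup_{r\to\infty}\frac{\log M_f(r)}{r^\rho}$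 ($\sigma=\infty$ if no such $A$ exists). Convention: a term with $a_n=0$ counts as $0$ in the first upper limit. *)

(* Defs.v *)
From HB Require Import structures.
From mathcomp Require Import all_boot all_order all_algebra ring lra.
From mathcomp Require Import all_classical all_reals all_analysis.

Set Implicit Arguments.
Unset Strict Implicit.
Unset Printing Implicit Defensive.

Import Order.TTheory GRing.Theory Num.Theory.
Import numFieldNormedType.Exports.

Local Open Scope classical_set_scope.
Local Open Scope ring_scope.

Record quaternion (R : Type) :=
  Quaternion { qre : R; qimi : R; qimj : R; qimk : R }.

Section QuaternionAlgebra.
Variable R : realType.
Local Notation H := (quaternion R).
Implicit Types (p q s : H) (c : R).

Definition tuple_of_quat q := (qre q, qimi q, qimj q, qimk q).
Definition quat_of_tuple (t : R * R * R * R) :=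
  let: (a, b, c, d) := t in Quaternion a b c d.

Lemma tuple_of_quatK : cancel tuple_of_quat quat_of_tuple.
Proof. by case. Qed.

HB.instance Definition _ := Choice.copy H (can_type tuple_of_quatK).

Definition quat_add p q := Quaternion (qre p + qre q) (qimi p + qimi q)
  (qimj p + qimj q) (qimk p + qimk q).
Definition quat_opp q :=
  Quaternion (- qre q) (- qimi q) (- qimj q) (- qimk q).
Definition quat_scale c q :=
  Quaternion (c * qre q) (c * qimi q) (c * qimj q) (c * qimk q).
Definition quat_mul p q :=
  let: Quaternion a1 b1 c1 d1 := p in let: Quaternion a2 b2 c2 d2 := q in
  Quaternion (a1 * a2 - b1 * b2 - c1 * c2 - d1 * d2)
             (a1 * b2 + b1 * a2 + c1 * d2 - d1 * c2)
             (a1 * c2 - b1 * d2 + c1 * a2 + d1 * b2)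
             (a1 * d2 + b1 * c2 - c1 * b2 + d1 * a2).

Lemma quat_addA : associative quat_add.
Proof. by case=> ? ? ? ? [? ? ? ?] [? ? ? ?]; congr Quaternion; rewrite /=; ring. Qed.

Lemma quat_addC : commutative quat_add.
Proof. by case=> ? ? ? ? [? ? ? ?]; congr Quaternion; rewrite /=; ring. Qed.

Lemma quat_add0 : left_id (Quaternion 0 0 0 0) quat_add.
Proof. by case=> ? ? ? ?; congr Quaternion; rewrite /=; ring. Qed.

Lemma quat_addN : left_inverse (Quaternion 0 0 0 0) quat_opp quat_add.
Proof. by case=> ? ? ? ?; congr Quaternion; rewrite /=; ring. Qed.

HB.instance Definition _ :=
  GRing.isZmodule.Build H quat_addA quat_addC quat_add0 quat_addN.

Lemma quat_mulA : associative quat_mul.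
Proof. by case=> ? ? ? ? [? ? ? ?] [? ? ? ?]; congr Quaternion; ring. Qed.

Lemma quat_mul1l : left_id (Quaternion 1 0 0 0) quat_mul.
Proof. by case=> ? ? ? ?; congr Quaternion; ring. Qed.

Lemma quat_mul1r : right_id (Quaternion 1 0 0 0) quat_mul.
Proof. by case=> ? ? ? ?; congr Quaternion; ring. Qed.

Lemma quat_mulDl : left_distributive quat_mul +%R.
Proof. by case=> ? ? ? ? [? ? ? ?] [? ? ? ?]; congr Quaternion; rewrite /=; ring. Qed.

Lemma quat_mulDr : right_distributive quat_mul +%R.
Proof. by case=> ? ? ? ? [? ? ? ?] [? ? ? ?]; congr Quaternion; rewrite /=; ring. Qed.

Lemma quat_1neq0 : Quaternion 1 0 0 0 != 0 :> H.
Proof. by apply/eqP => -[] /eqP; rewrite oner_eq0. Qed.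

HB.instance Definition _ := GRing.Zmodule_isNzRing.Build H
  quat_mulA quat_mul1l quat_mul1r quat_mulDl quat_mulDr quat_1neq0.

Lemma quat_scaleA c d q : quat_scale c (quat_scale d q) = quat_scale (c * d) q.
Proof. by congr Quaternion; rewrite /=; ring. Qed.

Lemma quat_scale1 : left_id 1 quat_scale.
Proof. by case=> ? ? ? ?; congr Quaternion; rewrite /=; ring. Qed.

Lemma quat_scaleDr : right_distributive quat_scale +%R.
Proof. by move=> c [? ? ? ?] [? ? ? ?]; congr Quaternion; rewrite /=; ring. Qed.

Lemma quat_scaleDl q : {morph quat_scale^~ q : c d / c + d}.
Proof. by move=> c d; congr Quaternion; rewrite /=; ring. Qed.

HB.instance Definition _ := GRing.Zmodule_isLmodule.Build R H
  quat_scaleA quat_scale1 quat_scaleDr quat_scaleDl.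

Lemma quat_scaleAl c p q : c *: (p * q) = (c *: p) * q.
Proof. by case: p q => ? ? ? ? [? ? ? ?]; congr Quaternion; rewrite /=; ring. Qed.

HB.instance Definition _ := GRing.Lmodule_isLalgebra.Build R H quat_scaleAl.

Lemma quat_scaleAr c p q : c *: (p * q) = p * (c *: q).
Proof. by case: p q => ? ? ? ? [? ? ? ?]; congr Quaternion; rewrite /=; ring. Qed.

HB.instance Definition _ := GRing.Lalgebra_isAlgebra.Build R H quat_scaleAr.

Definition quat_sqnorm q :=
  qre q ^+ 2 + qimi q ^+ 2 + qimj q ^+ 2 + qimk q ^+ 2.
Definition quat_norm q := Num.sqrt (quat_sqnorm q).

Lemma quat_sqnorm_ge0 q : 0 <= quat_sqnorm q.
Proof. by rewrite /quat_sqnorm !addr_ge0// sqr_ge0. Qed.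

Lemma quat_normD p q : quat_norm (p + q) <= quat_norm p + quat_norm q.
Proof.
have [np nq] : 0 <= quat_norm p /\ 0 <= quat_norm q by rewrite !sqrtr_ge0.
rewrite -(ler_pXn2r (ltn0Sn 1)) ?nnegrE ?addr_ge0// ?sqrtr_ge0//.
rewrite sqrrD !sqr_sqrtr ?quat_sqnorm_ge0//.
set d := qre p * qre q + qimi p * qimi q + qimj p * qimj q + qimk p * qimk q.
suff dle : d <= quat_norm p * quat_norm q.
  have -> : quat_sqnorm (p + q) = quat_sqnorm p + d *+ 2 + quat_sqnorm q.
    by rewrite /quat_sqnorm /d /=; ring.
  by rewrite lerD2r lerD2l lerMn2r dle.
rewrite -sqrtrM ?quat_sqnorm_ge0// (le_trans (ler_norm _))//.
rewrite -sqrtr_sqr ler_sqrt ?mulr_ge0 ?quat_sqnorm_ge0// -subr_ge0.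
have -> : quat_sqnorm p * quat_sqnorm q - d ^+ 2 =
    (qre p * qimi q - qimi p * qre q) ^+ 2 +
    (qre p * qimj q - qimj p * qre q) ^+ 2 +
    (qre p * qimk q - qimk p * qre q) ^+ 2 +
    (qimi p * qimj q - qimj p * qimi q) ^+ 2 +
    (qimi p * qimk q - qimk p * qimi q) ^+ 2 +
    (qimj p * qimk q - qimk p * qimj q) ^+ 2.
  by rewrite /quat_sqnorm /d; ring.
by rewrite !addr_ge0// sqr_ge0.
Qed.

Lemma quat_normZ c q : quat_norm (c *: q) = `|c| * quat_norm q.
Proof.
rewrite /quat_norm -sqrtr_sqr -sqrtrM ?sqr_ge0//; congr Num.sqrt.
by rewrite /quat_sqnorm /=; ring.
Qed.

Lemma quat_norm0_eq0 q : quat_norm q = 0 -> q = 0.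
Proof.
move=> /eqP; rewrite sqrtr_eq0 /quat_sqnorm; case: q => a b c d /= h.
have := (sqr_ge0 a, sqr_ge0 b, sqr_ge0 c, sqr_ge0 d).
move=> [[[a0 b0] c0] d0].
by congr Quaternion; apply/eqP; rewrite -sqrf_eq0 eq_le; apply/andP; split=> //; lra.
Qed.

HB.instance Definition _ :=
  Lmodule_isNormed.Build R H quat_normD quat_normZ quat_norm0_eq0.

Lemma quat_normE q : `|q| = Num.sqrt
  (qre q ^+ 2 + qimi q ^+ 2 + qimj q ^+ 2 + qimk q ^+ 2).
Proof. by []. Qed.

End QuaternionAlgebra.

Section SliceRegular.
Variable R : realType.
Local Notation H := (quaternion R).
Implicit Types (f : H -> H) (U : set H).

Definition imaginary_units : set H := [set I | I ^+ 2 = -1].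

(* [x%:A + I * y%:A] is the point x + I y of the complex plane C_I; since [U] is
   open, the values of [f] outside [U] do not influence the derivatives. *)
Definition slice_regular U f : Prop :=
  [/\ open U,
      forall q, U q -> differentiable f q &
      forall I : H, imaginary_units I -> forall x y : R,
        U (x%:A + I * y%:A) ->
        2^-1 *: (derive1 (fun t : R => f (t%:A + I * y%:A)) x +
                 I * derive1 (fun t : R => f (x%:A + I * t%:A)) y) = 0].

End SliceRegular.

Section Growth.
Variable R : realType.
Local Notation H := (quaternion R).
Implicit Types f : H -> H.
Local Open Scope ereal_scope.

(* For continuous [f] and [0 <= r] the supremum is a maximum, by compactness of
   the sphere. *)
Definition max_modulus f (r : R) : \bar R :=
  ereal_sup [set `|f q|%:E | q in [set q : H | `|q|%R = r]].

(* Infima in the extended reals: the order is [+oo] when no [k] qualifies. *)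
Definition growth_order f : \bar R :=
  ereal_inf [set k%:E | k in [set k : R | (0 < k)%R /\
    \forall r \near +oo%R, max_modulus f r < (expR (r `^ k))%:E]].

(* Meaningful only when [growth_order f] is finite. *)
Definition growth_type f : \bar R :=
  let rho := fine (growth_order f) in
  ereal_inf [set A%:E | A in [set A : R | (0 < A)%R /\
    \forall r \near +oo%R, max_modulus f r < (expR (A * r `^ rho))%:E]].

End Growth.

(* Main.v *)
(* Everything follows from two comparisons between the maximum modulus M and
   the coefficients. Averaging f over the N-th roots of unity of the circle of
   radius r in the slice C_i gives Cauchy's inequality |a_n| r^n <= M(r), with
   no integral; choosing r^k = n / (A k), a bound M(r) < exp (A r^k) yields
   |a_n| <= (e A k / n)^(n / k). Conversely, under this bound on |a_n|, for
   B > A the n-th term of the series is at most C t^n exp (B r^k) with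
   t = (A / B)^(1 / k) < 1, so M(r) = O(exp (B r^k)). Taking A = 1 or
   A = 1 / (e k) gives the order, and k = rho the type. *)

Require Import Defs.
From HB Require Import structures.
From mathcomp Require Import all_boot all_order all_algebra.
From mathcomp Require Import all_classical all_reals all_analysis.
From mathcomp Require Import ring lra.

Set Implicit Arguments.
Unset Strict Implicit.
Unset Printing Implicit Defensive.

Import Order.TTheory GRing.Theory Num.Theory.
Import numFieldNormedType.Exports.
Local Open Scope classical_set_scope.
Local Open Scope ring_scope.

(** * Multiplicative norm and Cauchy's inequality for quaternionic polynomials *)

Section Quaternions.
Variable R : realType.
Local Notation H := (quaternion R).
Implicit Types (p q : H) (x y : R).

Lemma quat_normM p q : `|p * q| = `|p| * `|q|.
Proof.
rewrite !quat_normE -sqrtrM; last exact: quat_sqnorm_ge0.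
by congr Num.sqrt; case: p q => ? ? ? ? [? ? ? ?] /=; ring.
Qed.

Lemma quat_norm1 : `|1 : H| = 1.
Proof. by rewrite quat_normE /= expr1n expr0n !addr0 sqrtr1. Qed.

Lemma quat_normX q n : `|q ^+ n| = `|q| ^+ n.
Proof.
elim: n => [|n IH]; first by rewrite !expr0 quat_norm1.
by rewrite !exprS quat_normM IH.
Qed.

Definition quat_expi x : H := Quaternion (cos x) (sin x) 0 0.

Lemma quat_expi0 : quat_expi 0 = 1.
Proof. by rewrite /quat_expi cos0 sin0. Qed.

Lemma quat_expiD x y : quat_expi (x + y) = quat_expi x * quat_expi y.
Proof. by rewrite /quat_expi cosD sinD; congr Quaternion; ring. Qed.

Lemma quat_expiM x n : quat_expi (x *+ n) = quat_expi x ^+ n.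
Proof.
elim: n => [|n IH]; first by rewrite mulr0n expr0 quat_expi0.
by rewrite mulrS exprS quat_expiD IH.
Qed.

Lemma quat_norm_expi x : `|quat_expi x| = 1.
Proof.
by rewrite quat_normE /= cos2Dsin2 expr0n !addr0 sqrtr1.
Qed.

Lemma quat_expi_2pi_nat n : quat_expi (pi *+ 2 *+ n) = 1.
Proof.
rewrite quat_expiM.
have -> : quat_expi (pi *+ 2) = 1 by rewrite /quat_expi cos2pi sin2pi.
by rewrite expr1n.
Qed.

(** By the half-angle formula, [cos |x| = 1] would force [sin (|x| / 2) = 0], whereas [|x| / 2] lies
    strictly between 0 and [pi]. *)
Lemma quat_expi_neq1 x : 0 < `|x| < pi *+ 2 -> quat_expi x != 1.
Proof.
move=> /andP[x0 x2]; apply/eqP => -[cx _].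
have cnx : cos `|x| = 1 by case: (ger0P x) => _ //; rewrite cosN.
have := cos_mulr2n (`|x| / 2).
have -> : `|x| / 2 *+ 2 = `|x| by rewrite -mulr_natr divfK.
have := cos2Dsin2 (`|x| / 2).
have : 0 < sin (`|x| / 2).
  by apply: sin_gt0_pi; rewrite divr_gt0//= ltr_pdivrMr// mulr_natr.
by rewrite cnx => s0 /[swap] h; nra.
Qed.

(** The summands are the powers of an N-th root of unity u different from 1, and (u - 1) times their
    sum is u^N - 1 = 0. *)
Lemma quat_sum_expi (m n N : nat) : (m < N)%N -> (n < N)%N -> m != n ->
  \sum_(k < N) quat_expi ((m%:R - n%:R) * (pi *+ 2 / N%:R)) ^+ k = 0.
Proof.
move=> mN nN mn; set x := _ * _.
have N0 : 0 < N%:R :> R by rewrite ltr0n (leq_ltn_trans _ mN).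
have pi0 : 0 < pi *+ 2 :> R by rewrite pmulrn_lgt0// pi_gt0.
have xN : quat_expi x ^+ N = 1.
  rewrite -quat_expiM.
  have -> : x *+ N = pi *+ 2 *+ m - pi *+ 2 *+ n.
    rewrite /x -[LHS]mulr_natr -mulrA divfK ?gt_eqF//.
    by rewrite mulrBl !mulr_natl.
  have := quat_expi_2pi_nat m; rewrite -[in X in X -> _](subrK (pi *+ 2 *+ n) (pi *+ 2 *+ m)).
  by rewrite quat_expiD quat_expi_2pi_nat mulr1.
have x1 : quat_expi x != 1.
  have t0 : 0 < pi *+ 2 / N%:R :> R by rewrite divr_gt0.
  apply: quat_expi_neq1; rewrite normrM (gtr0_norm t0); apply/andP; split.
    by rewrite mulr_gt0// normr_gt0 subr_eq0 eqr_nat.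
  (* Both indices lie below [N], so |m - n| < N and the angle stays below a full turn. *)
  rewrite mulrCA gtr_pMr // ltr_pdivrMr// mul1r.
  rewrite ltr_norml.
  have := ltr_nat R m N; have := ltr_nat R n N; rewrite mN nN => h1 h2.
  have := ler0n R m; have := ler0n R n; lra.
(* Taking norms turns the vanishing product into one of real numbers, where a factor must vanish. *)
have := subrX1 (quat_expi x) N; rewrite xN subrr => /esym/(congr1 Num.norm).
rewrite quat_normM normr0 => /eqP; rewrite mulf_eq0 normr_eq0 subr_eq0 (negbTE x1)/=.
by rewrite normr_eq0 => /eqP.
Qed.

(* Averaging [expi (- n k t) * P (r expi (k t))] over the [N]-th roots of unity
   ([t = 2 pi / N]) isolates the coefficient of index [n]. *)
Lemma quat_cauchy_poly (a : nat -> H) (N : nat) (r B : R) : 0 <= r ->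
  (forall q, `|q| = r -> `|\sum_(m < N) q ^+ m * a m| <= B) ->
  forall n, (n < N)%N -> r ^+ n * `|a n| <= B.
Proof.
move=> r0 hB n nN; set t : R := pi *+ 2 / N%:R.
have N0 : 0 < N%:R :> R by rewrite ltr0n (leq_ltn_trans _ nN).
have E : \sum_(k < N) quat_expi (- (t *+ n *+ k)) *
    (\sum_(m < N) (r *: quat_expi (t *+ k)) ^+ m * a m) = (N%:R * r ^+ n) *: a n.
  under eq_bigr do rewrite mulr_sumr.
  rewrite exchange_big/= (bigD1 (Ordinal nN))//= [X in _ + X]big1 ?addr0.
    transitivity (\sum_(k < N) (r ^+ n *: a n)).
      apply: eq_bigr => k _.
      (* The coefficients stand on the right, so the exponentials on the left combine within one
         slice, where they commute. *)
      rewrite mulrA exprZn -scalerAr -scalerAl -quat_expiM -quat_expiD.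
      by rewrite [t *+ k *+ n]mulrnAC addNr quat_expi0 mul1r.
    by rewrite sumr_const card_ord -scaler_nat scalerA.
  move=> m mn.
  transitivity (r ^+ m *: ((\sum_(k < N)
      quat_expi ((m%:R - n%:R) * t) ^+ k) * a m)).
    rewrite mulr_suml scaler_sumr; apply: eq_bigr => k _.
    rewrite mulrA exprZn -scalerAr -scalerAl -!quat_expiM -quat_expiD.
    congr (_ *: (quat_expi _ * _)).
    rewrite -!mulrnA -[in LHS](mulr_natr t (k * m)).
    rewrite -[in LHS](mulr_natr t (n * k)) -[RHS]mulr_natr !natrM.
    by ring.
  by rewrite quat_sum_expi ?mul0r ?scaler0.
rewrite -(ler_pM2l N0) mulrA.
have -> : N%:R * r ^+ n * `|a n| = `|(N%:R * r ^+ n) *: a n|.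
  by rewrite normrZ ger0_norm// mulr_ge0 ?exprn_ge0.
rewrite -E (le_trans (ler_norm_sum _ _ _))//.
have -> : N%:R * B = \sum_(k < N) B by rewrite sumr_const card_ord mulr_natl.
apply: ler_sum => k _; rewrite quat_normM quat_norm_expi mul1r hB//.
by rewrite normrZ quat_norm_expi mulr1 ger0_norm.
Qed.

End Quaternions.

Lemma sum_geometric_half (R : realType) N d :
  \sum_(N <= m < N + d) (2^-1 : R) ^+ m <= 2 * 2^-1 ^+ N.
Proof.
have -> : \sum_(N <= m < N + d) (2^-1 : R) ^+ m =
    2 * (2^-1 ^+ N - 2^-1 ^+ (N + d)).
  elim: d => [|d IH]; first by rewrite addn0 big_geq// subrr mulr0.
  rewrite addnS big_nat_recr ?leq_addr//= IH exprS; lra.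
by rewrite ler_pM2l// gerBl exprn_ge0.
Qed.

(** * Coefficients against the maximum modulus of an entire series *)

Section EntireSeries.
Variables (R : realType) (f : quaternion R -> quaternion R).
Variable a : nat -> quaternion R.
Hypothesis hser : forall q, series (fun n => q ^+ n * a n) @ \oo --> f q.
Local Notation H := (quaternion R).

Lemma entire_le_abs_series r B (q : H) :
  (forall N, \sum_(m < N) r ^+ m * `|a m| <= B) -> `|q| = r -> `|f q| <= B.
Proof.
move=> hB qr; have hc : `|series (fun n => q ^+ n * a n) N| @[N --> \oo] --> `|f q|.
  by apply: cvg_norm; exact: hser.
rewrite -(cvg_lim _ hc)//; apply: limr_le; first by apply/cvg_ex; eexists; exact: hc.
apply: nearW => N /=; rewrite seriesEord /=.
rewrite (le_trans (ler_norm_sum _ _ _))// (le_trans _ (hB N))//.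
by apply: ler_sum => m _; rewrite quat_normM quat_normX qr.
Qed.

Lemma entire_coef_decay r : 0 <= r ->
  \forall n \near \oo, r ^+ n * `|a n| <= 1.
Proof.
move=> r0; have hc : cvgn (series (fun n => (r%:A : H) ^+ n * a n)).
  by apply/cvg_ex; eexists; exact: hser.
have [N0 _ hN0] := cvgr0_norm_le _ (cvg_series_cvg_0 hc) _ (ltr01 : 0 < 1 :> R).
exists N0 => // n /= /hN0 /=; rewrite quat_normM quat_normX.
by rewrite normrZ quat_norm1 mulr1 ger0_norm.
Qed.

(** Coefficient decay at radius 2r gives r^m |a_m| <= 2^-m, so a geometric tail bounds the error
    uniformly on the sphere. *)
Lemma entire_uniform_tail r : 0 <= r -> \forall N \near \oo,
  forall q : H, `|q| = r ->
  `|f q - \sum_(m < N) q ^+ m * a m| <= 2 * 2^-1 ^+ N.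
Proof.
move=> r0; have [N0 _ hN0] := entire_coef_decay (mulr_ge0 (ler0n R 2) r0).
exists N0 => //= N /= N0N q qr.
have hc : `|series (fun n => q ^+ n * a n) L - \sum_(m < N) q ^+ m * a m|
    @[L --> \oo] --> `|f q - \sum_(m < N) q ^+ m * a m|.
  by apply: cvg_norm; apply: cvgB; [exact: hser|exact: cvg_cst].
rewrite -(cvg_lim _ hc)//; apply: limr_le; first by apply/cvg_ex; eexists; exact: hc.
exists N => //= L /= NL; rewrite -(big_mkord xpredT (fun m => q ^+ m * a m)).
have -> : series (fun n => q ^+ n * a n) L - \sum_(0 <= i < N) q ^+ i * a i =
    \sum_(N <= m < L) q ^+ m * a m.
  by rewrite /series/= (big_cat_nat (leq0n N) NL)/= addrAC subrr add0r.
rewrite (le_trans (ler_norm_sum _ _ _))//.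
rewrite (le_trans _ (sum_geometric_half R N (L - N)))// subnKC//.
apply: ler_sum_nat => m /andP[Nm _].
have := hN0 m (leq_trans N0N Nm); rewrite quat_normM quat_normX qr exprMn -mulrA.
by rewrite exprVn -ler_pdivlMl ?exprn_gt0// mulr1.
Qed.

(** Partial sums are bounded by B + e on the sphere once [N] is large. Uniformity of the tail
    matters: the polynomial inequality needs one [N] for all points of the sphere. *)
Lemma entire_cauchy r B : 0 <= r ->
  (forall q : H, `|q| = r -> `|f q| <= B) -> forall n, r ^+ n * `|a n| <= B.
Proof.
move=> r0 hB n; apply/ler_addgt0Pr => e e0.
have h0 : (fun N : nat => 2 * 2^-1 ^+ N : R) @ \oo --> (0 : R).
  rewrite -[X in _ --> X](mulr0 2); apply: cvgMr; apply: cvg_expr.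
  by rewrite ger0_norm ?invr_ge0// invf_lt1// ltr1n.
have hs := cvgr0_norm_le _ h0 _ e0.
near \oo => N.
apply: (@quat_cauchy_poly _ _ N) => // [q qr|]; last first.
  by near: N; exact: nbhs_infty_gt.
rewrite -[X in `|X|](subrKC (f q)) (le_trans (ler_normD _ _))// lerD ?hB//.
rewrite -normrN opprB.
have /le_trans : `|f q - \sum_(m < N) q ^+ m * a m| <= 2 * 2^-1 ^+ N.
  by move: q qr; near: N; exact: entire_uniform_tail.
apply; rewrite (le_trans (ler_norm _))//; near: N; exact: hs.
Unshelve. all: by end_near.
Qed.

Lemma max_modulus_le r B :
  (forall N, \sum_(m < N) r ^+ m * `|a m| <= B) -> (max_modulus f r <= B%:E)%E.
Proof.
move=> hB; apply: ge_ereal_sup => _ [q qr <-]; rewrite lee_fin.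
exact: entire_le_abs_series hB qr.
Qed.

Lemma max_modulus_cauchy r B : 0 <= r -> (max_modulus f r < B%:E)%E ->
  forall n, r ^+ n * `|a n| <= B.
Proof.
move=> r0 hB; apply: entire_cauchy => // q qr; rewrite -lee_fin.
by apply: le_trans (ltW hB); apply: ereal_sup_ubound; exists q.
Qed.

End EntireSeries.

(** * Growth bounds exp (A r^k) and the matching coefficient bounds *)

Section PowerGrowth.
Variable R : realType.

Lemma near_ln_ge (c : R) : \forall n \near \oo, c <= ln (n%:R : R).
Proof.
have [N _ hN] := nbhs_infty_ger (expR c).
exists N => // n /= /hN h.
by rewrite -[c]expRK ler_ln ?posrE ?expR_gt0// (lt_le_trans _ h) ?expR_gt0.
Qed.

Lemma near_powR_gt (k c : R) : 0 < k -> \forall r \near +oo, c < r `^ k.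
Proof.
move=> k0; exists (expR (c / k)); split; first exact: num_real.
move=> r /= cr; have r0 := lt_trans (expR_gt0 _) cr.
(* The bound used is r^k = exp (k ln r) >= 1 + k ln r > c. *)
rewrite /powR gt_eqF// (lt_le_trans _ (expR_ge1Dx _))// ltr_pwDl//.
by rewrite mulrC -ler_pdivrMr// -[leLHS]expRK ler_ln ?posrE ?expR_gt0// ltW.
Qed.

(* This is [(e A k / n) ^ (n / k)], the minimum over [r] of
   [exp (A r ^ k) / r ^ n]. *)
Definition coef_bound (A k : R) (n : nat) : R :=
  expR (n%:R / k * (ln (A * k) + 1 - ln n%:R)).

(** After taking logarithms and dividing by n / k, this is ln x <= x - 1 at x = B k r^k / n. The
    index 0, where that division fails, is treated apart. *)
Lemma coef_bound_term (A B k r : R) (n : nat) :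
  0 < A -> 0 < B -> 0 < k -> 0 < r ->
  r ^+ n * coef_bound A k n <=
  expR ((ln A - ln B) / k) ^+ n * expR (B * r `^ k).
Proof.
move=> A0 B0 k0 r0; have Bpos : 0 <= B * r `^ k by rewrite mulr_ge0 ?powR_ge0// ltW.
rewrite -[in r ^+ n](lnK r0) -!expRM_natl -!expRD ler_expR.
case: n => [|n]; first by rewrite !mul0r !add0r.
have n0 : 0 < n.+1%:R :> R by rewrite ltr0n.
set N := n.+1%:R in n0 *; set x := B * r `^ k * k / N.
have x0 : 0 < x by rewrite !mulr_gt0 ?invr_gt0// powR_gt0.
have lnx : ln x = ln B + k * ln r + ln k - ln N.
  rewrite /x !lnM ?posrE ?mulr_gt0 ?invr_gt0 ?powR_gt0//.
  by rewrite lnV ?posrE// ln_powR.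
have : ln x <= x - 1.
  by have := @le_ln1Dx R (x - 1); rewrite subrKC; apply; lra.
rewrite lnx lnM ?posrE// => h.
have -> : B * r `^ k = N / k * x by rewrite /x; field; rewrite !gt_eqF.
have Nk0 : 0 < N / k by rewrite divr_gt0.
have := ler_wpM2l (ltW Nk0) h.
have -> : N * ln r = N / k * (k * ln r) by field; rewrite gt_eqF.
have -> : N * ((ln A - ln B) / k) = N / k * (ln A - ln B) by field; rewrite gt_eqF.
by set K := N / k; lra.
Qed.

Lemma sum_geometric_le (t : R) N : 0 <= t < 1 -> \sum_(m < N) t ^+ m <= (1 - t)^-1.
Proof.
move=> /andP[t0 t1]; have := subrX1 t N => h.
rewrite -[leRHS]mul1r ler_pdivlMr ?subr_gt0//.
have := exprn_ge0 N t0; lra.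
Qed.

(** Since [coef_bound] is positive, the finitely many exceptional indices are absorbed by adding
    their ratios to the constant. *)
Lemma coef_bound_const (b : nat -> R) (A k : R) :
  (\forall n \near \oo, b n <= coef_bound A k n) ->
  exists2 C, 0 < C & forall n, b n <= C * coef_bound A k n.
Proof.
move=> [N _ hN].
exists (1 + \sum_(i < N) `|b i| / coef_bound A k i).
  by rewrite ltr_pwDl// sumr_ge0// => i _; rewrite divr_ge0// expR_ge0.
move=> n; have [Nn|nN] := leqP N n.
  rewrite (le_trans (hN _ Nn))// ler_peMl ?expR_ge0// lerDl.
  by rewrite sumr_ge0// => i _; rewrite divr_ge0// expR_ge0.
rewrite -ler_pdivrMr ?expR_gt0// (bigD1 (Ordinal nN))//= addrCA.
rewrite ler_wpDr//; last by rewrite ler_pM2r ?invr_gt0 ?expR_gt0// ler_norm.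
by rewrite addr_ge0// sumr_ge0// => i _; rewrite divr_ge0// expR_ge0.
Qed.

Variables (f : quaternion R -> quaternion R) (a : nat -> quaternion R).
Hypothesis hser : forall q, series (fun n => q ^+ n * a n) @ \oo --> f q.

Lemma coef_bound_of_growth (A k : R) : 0 < A -> 0 < k ->
  (\forall r \near +oo, (max_modulus f r < (expR (A * r `^ k))%:E)%E) ->
  \forall n \near \oo, `|a n| <= coef_bound A k n.
Proof.
move=> A0 k0 [M [_ hM]].
have [N _ hN] := near_ln_ge (M * k + ln (A * k)).
exists (maxn N 1) => //= n /=; rewrite geq_max => /andP[/hN /= hn n0].
have n0' : 0 < n%:R :> R by rewrite ltr0n.
have Ak : 0 < A * k by rewrite mulr_gt0.
(* [x] is the logarithm of the optimal radius, where A r^k = n / k; the choice of [N] ensures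
   [M <= x < expR x]. *)
set x := (ln n%:R - ln (A * k)) / k.
have Mx : M <= x by rewrite ler_pdivlMr//; lra.
have /hM : M < expR x by have := expR_ge1Dx x; lra.
move=> /(max_modulus_cauchy hser (expR_ge0 _)) /(_ n).
have -> : A * expR x `^ k = n%:R / k.
  rewrite -expRM /x divfK ?gt_eqF// expRB !lnK ?posrE//.
  by field; rewrite !gt_eqF.
rewrite -expRM_natl mulrC -ler_pdivlMr ?expR_gt0// -expRB => /le_trans; apply.
rewrite ler_expR le_eqVlt; apply/orP; left; apply/eqP.
by rewrite /x; field; rewrite gt_eqF.
Qed.

Lemma growth_of_coef_bound (A B k : R) : 0 < A -> A < B -> 0 < k ->
  (\forall n \near \oo, `|a n| <= coef_bound A k n) ->
  \forall r \near +oo, (max_modulus f r < (expR (B * r `^ k))%:E)%E.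
Proof.
move=> A0 AB k0 /coef_bound_const[C C0 hC].
(* The gap A < B' makes the ratio [t] of the geometric series less than 1; the gap B' < B lets exp
   ((B - B') r^k) absorb the constant [D]. *)
set B' := (A + B) / 2; have B'0 : 0 < B' by rewrite /B'; lra.
have AB' : A < B' by rewrite /B'; lra.
set t := expR ((ln A - ln B') / k).
have t1 : 0 <= t < 1.
  rewrite expR_ge0/= expR_lt1 pmulr_llt0 ?invr_gt0// subr_lt0.
  by rewrite ltr_ln ?posrE.
set D := C / (1 - t); have D0 : 0 < D.
  by rewrite divr_gt0// subr_gt0; case/andP: t1.
have hgt := near_powR_gt (ln D / (B - B')) k0.
near=> r; have r0 : 0 < r by near: r; exact: nbhs_pinfty_gt.
have /(max_modulus_le hser)/le_lt_trans : forall N,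
    \sum_(m < N) r ^+ m * `|a m| <= D * expR (B' * r `^ k).
  move=> N.
  have -> : D * expR (B' * r `^ k) = (C * expR (B' * r `^ k)) * (1 - t)^-1.
    by rewrite /D mulrAC.
  apply: le_trans (ler_wpM2l _ (sum_geometric_le N t1)); last first.
    by rewrite mulr_ge0 ?expR_ge0// ltW.
  rewrite mulr_sumr; apply: ler_sum => m _.
  rewrite -mulrA [X in C * X]mulrC.
  apply: (@le_trans _ _ (C * (r ^+ m * coef_bound A k m))).
    by rewrite mulrCA ler_wpM2l ?hC// exprn_ge0// ltW.
  by rewrite ler_wpM2l ?coef_bound_term// ltW.
apply; rewrite lte_fin -[D]lnK ?posrE// -expRD ltr_expR -ltrBrDr -mulrBl.
rewrite mulrC -ltr_pdivrMr; first by near: r.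
by rewrite /B'; lra.
Unshelve. all: by end_near.
Qed.

End PowerGrowth.

(** * Upper limits in the extended reals *)

Section UpperLimit.
Variable R : realType.
Implicit Types (u : nat -> \bar R) (c : \bar R).
Local Open Scope ereal_scope.

Lemma limn_esup_le_near u c : (\forall n \near \oo, u n <= c) -> limn_esup u <= c.
Proof.
move=> uc; apply: le_trans (_ : ereal_sup (u @` [set n | u n <= c]) <= c).
  by apply: ereal_inf_lbound; exists [set n | u n <= c].
by apply: ge_ereal_sup => _ [n /= un <-].
Qed.

Lemma limn_esup_lt_near u c : limn_esup u < c -> \forall n \near \oo, u n < c.
Proof.
move=> /ereal_inf_lt[_ [V VF <-] Vc]; apply: filterS VF => n Vn.
by apply: le_lt_trans Vc; apply: ereal_sup_ubound; exists n.
Qed.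

Lemma limn_esup_ge_near u c : (\forall n \near \oo, c <= u n) -> c <= limn_esup u.
Proof.
move=> uc; apply: le_ereal_inf_tmp => _ [V VF <-].
have [n [Vn un]] := filter_ex (filterI VF uc).
by apply: le_trans un _; apply: ereal_sup_ubound; exists n.
Qed.

(** This reduces each inequality of the growth formulas to finite positive thresholds c, for which
    logarithms and real powers behave well. *)
Lemma ereal_le_pos x y : 0 <= x ->
  (forall c : R, (0 < c)%R -> x < c%:E -> y <= c%:E) -> y <= x.
Proof.
case: x => [x| |]; rewrite ?leey// lee_fin => x0 h.
apply/lee_addgt0Pr => e e0; apply: h; first by rewrite ltr_wpDl.
by rewrite lte_fin ltrDl.
Qed.

End UpperLimit.

(** * Each limsup term against [coef_bound] *)

Section Coefficients.
Variables (R : realType).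
Implicit Types (k c : R).

(** The coefficient bound reads -ln b >= (n / k) (ln n - ln k - 1), so the quotient is at most k ln
    n / (ln n - ln k - 1). This tends to k, and the two conditions on [ln n] say that it is defined,
    positive and already at most k'. *)
Lemma order_term_le k k' (b : R) (n : nat) : 0 < k -> k < k' -> 0 < b ->
  (0 < n)%N -> ln k + 1 < ln n%:R -> k' * (ln k + 1) <= (k' - k) * ln n%:R ->
  b <= coef_bound 1 k n -> n%:R * ln n%:R / ln (1 / b) <= k'.
Proof.
move=> k0 kk' b0 n0 h1 h2 hb.
have n0' : 0 < n%:R :> R by rewrite ltr0n.
have nk0 : 0 < n%:R / k by rewrite divr_gt0.
have hl : n%:R / k * (ln n%:R - (ln k + 1)) <= - ln b.
  rewrite lerNr -mulrN opprB.
  by rewrite -[leRHS]expRK ler_ln ?posrE ?expR_gt0// -[in ln k](mul1r k).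
have L0 : 0 < - ln b by apply: lt_le_trans hl; rewrite mulr_gt0// subr_gt0.
rewrite div1r lnV ?posrE// ler_pdivrMr//.
have -> : n%:R * ln n%:R = n%:R / k * (k * ln n%:R) by field; rewrite gt_eqF.
apply: le_trans (ler_wpM2l (ltW (lt_trans k0 kk')) hl).
by rewrite [leRHS]mulrCA ler_pM2l//; lra.
Qed.

(** For A = 1 / (e k) one has ln (A k) + 1 = 0, so for n > 0 [coef_bound] is n^(-n/k). The condition
    b < 1 makes the denominator positive. *)
Lemma coef_bound_of_order_term k (b : R) (n : nat) : 0 < k -> 0 <= b -> b < 1 ->
  (b != 0 -> n%:R * ln n%:R / ln (1 / b) < k) ->
  b <= coef_bound ((expR 1 * k)^-1) k n.
Proof.
move=> k0 b0 b1 hb; have [->|bn0] := eqVneq b 0; first exact: expR_ge0.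
have bp : 0 < b by rewrite lt_def bn0.
have -> : coef_bound (expR 1 * k)^-1 k n = expR (- (n%:R * ln n%:R / k)).
  rewrite /coef_bound invfM mulfVK ?gt_eqF// lnV ?posrE ?expR_gt0// expRK.
  by congr expR; ring.
have := hb bn0; rewrite div1r lnV ?posrE//.
have L0 : 0 < - ln b by rewrite oppr_gt0 ln_lt0// bp.
rewrite ltr_pdivrMr// -ltr_pdivrMl// [k^-1 * _]mulrC => h.
by rewrite -[leLHS](lnK bp) ler_expR; lra.
Qed.

(** For A = c^k / (e k) one has ln (A k) + 1 = k ln c, so [coef_bound] is c^n n^(-n/k), and the two
    conditions differ by an n-th power. *)
Lemma type_term_le k c (b : R) (n : nat) : 0 < k -> 0 < c -> 0 <= b -> (0 < n)%N ->
  (n%:R `^ (1 / k) * b `^ (1 / n%:R) <= c) =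
  (b <= coef_bound (c `^ k / (expR 1 * k)) k n).
Proof.
move=> k0 c0 b0 n0; have n0' : 0 < n%:R :> R by rewrite ltr0n.
have [->|bn0] := eqVneq b 0.
  by rewrite powR0 ?mulr0 ?(ltW c0) ?expR_ge0// gt_eqF// divr_gt0.
have bp : 0 < b by rewrite lt_def bn0.
have -> : coef_bound (c `^ k / (expR 1 * k)) k n =
    expR (n%:R * (ln c - ln n%:R / k)).
  rewrite /coef_bound invfM mulrA mulfVK ?gt_eqF//.
  rewrite lnM ?posrE ?powR_gt0 ?invr_gt0 ?expR_gt0//.
  rewrite lnV ?posrE ?expR_gt0// expRK ln_powR.
  by congr expR; field; rewrite gt_eqF.
rewrite /powR !gt_eqF// -expRD -[in RHS](lnK bp) -[in LHS](lnK c0) !ler_expR.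
rewrite -(ler_pM2l n0').
have -> : n%:R * (1 / k * ln n%:R + 1 / n%:R * ln b) =
    n%:R * (ln n%:R / k) + ln b by field; rewrite !gt_eqF.
by rewrite mulrBr lerBrDl.
Qed.

End Coefficients.

(** * The formulas for order and type *)

Section GrowthFormulas.
Variables (R : realType) (f : quaternion R -> quaternion R).
Variable a : nat -> quaternion R.
Hypothesis hser : forall q, series (fun n => q ^+ n * a n) @ \oo --> f q.

Lemma entire_coef_lt1 : \forall n \near \oo, `|a n| < 1.
Proof.
have [N _ hN] := entire_coef_decay hser (ler0n R 2).
exists (maxn N 1) => //= n /=; rewrite geq_max => /andP[/hN /= h n0].
rewrite -ler_pdivlMl ?exprn_gt0// mulr1 in h; apply: le_lt_trans h _.
by rewrite invf_lt1 ?exprn_gt0// exprn_egt1 ?ltr1n// -lt0n.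
Qed.

Lemma growth_order_ge0 : (0 <= growth_order f)%E.
Proof. by apply: le_ereal_inf_tmp => _ [k [k0 _] <-]; rewrite lee_fin ltW. Qed.

Lemma growth_type_ge0 : (0 <= growth_type f)%E.
Proof. by apply: le_ereal_inf_tmp => _ [k [k0 _] <-]; rewrite lee_fin ltW. Qed.

Lemma growth_order_limn_esup : growth_order f =
  limn_esup (fun n => (if a n == 0 then 0
    else n%:R * ln n%:R / ln (1 / `|a n|))%:E).
Proof.
have lt1 := entire_coef_lt1.
apply/eqP; rewrite eq_le; apply/andP; split; apply: ereal_le_pos.
- apply: limn_esup_ge_near; case: lt1 => N _ hN; exists N => // n /= /hN /= h.
  rewrite lee_fin; case: eqVneq => // an0.
  have an : 0 < `|a n| by rewrite normr_gt0.
  case: n => [|n] in h an an0 *; first by rewrite !mul0r.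
  rewrite mulr_ge0 ?mulr_ge0 ?ln_ge0 ?ler1n// invr_ge0 ln_ge0// div1r.
  by rewrite invf_ge1// ltW.
- move=> k k0 /limn_esup_lt_near hk.
  (* The slack [e] in the exponent pays for the constant: eventually 2 A < r^e, hence 2 A r^k <=
     r^(k + e). *)
  apply/lee_addgt0Pr => e e0; apply: ereal_inf_lbound; exists (k + e) => //.
  split; first by rewrite addr_gt0.
  set A := (expR 1 * k)^-1.
  have A0 : 0 < A by rewrite invr_gt0 mulr_gt0 ?expR_gt0.
  have hb : \forall n \near \oo, `|a n| <= coef_bound A k n.
    near=> n; apply: coef_bound_of_order_term => //; first by near: n; exact: lt1.
    rewrite normr_eq0 => /negbTE an0.
    have : ((if a n == 0 then 0 else n%:R * ln n%:R / ln (1 / `|a n|))%:E < k%:E)%E.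
      by near: n; exact: hk.
    by rewrite an0 lte_fin.
  have hg := growth_of_coef_bound hser A0 (_ : A < 2 * A) k0 hb.
  have hp := near_powR_gt (2 * A) e0.
  near=> r; have r0 : 0 < r by near: r; exact: nbhs_pinfty_gt.
  apply: (@lt_le_trans _ _ (expR (2 * A * r `^ k))%:E).
    by near: r; apply: hg; lra.
  rewrite lee_fin ler_expR powRD; last by rewrite (gt_eqF r0) implybT.
  by rewrite mulrC ler_pM2l ?powR_gt0// ltW//; near: r.
- exact: growth_order_ge0.
- move=> k' k'0 /ereal_inf_lt[_ [k [k0 hk] <-]]; rewrite lte_fin => kk'.
  apply: limn_esup_le_near.
  have hb : \forall n \near \oo, `|a n| <= coef_bound 1 k n.
    apply: (coef_bound_of_growth hser ltr01 k0).
    by under eq_near do rewrite mul1r.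
  (* These are the two largeness conditions of [order_term_le]; the 2 makes the first one strict. *)
  have h1 := near_ln_ge (ln k + 2); have h2 := near_ln_ge ((k' - k)^-1 * (k' * (ln k + 1))).
  near=> n; rewrite lee_fin; case: eqVneq => [|an0]; first by rewrite ltW.
  apply: (order_term_le k0 kk').
  - by rewrite normr_gt0.
  - by near: n; exact: nbhs_infty_gt.
  - have : ln k + 2 <= ln n%:R by near: n.
    lra.
  - by rewrite -ler_pdivrMl ?subr_gt0//; near: n.
  - by near: n.
Unshelve. all: by end_near.
Qed.

(** The increasing bijection between c and A = c^k / (e k) translates thresholds for the limsup
    terms into candidates for the type. *)
Lemma growth_type_limn_esup (k : R) : 0 < k -> growth_order f = k%:E ->
  poweR (growth_type f * (expR 1 * k)%:E)%E (1 / k) =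
  limn_esup (fun n => (n%:R `^ (1 / k) * `|a n| `^ (1 / n%:R))%:E).
Proof.
move=> k0 fk; set s := growth_type f.
have ek0 : 0 < expR 1 * k by rewrite mulr_gt0 ?expR_gt0.
have k10 : 0 < 1 / k by rewrite divr_gt0.
have cK c : 0 < c -> (c `^ k) `^ (1 / k) = c.
  by move=> c0; rewrite -powRrM mul1r divff ?gt_eqF// powRr1// ltW.
have hterm c : 0 < c ->
    (\forall n \near \oo, ((n%:R `^ (1 / k) * `|a n| `^ (1 / n%:R))%:E <= c%:E)%E) <->
    \forall n \near \oo, `|a n| <= coef_bound (c `^ k / (expR 1 * k)) k n.
  (* The index 0 is discarded because the comparison extracts an n-th root. *)
  move=> c0; split=> -[N _ hN]; exists (maxn N 1) => //= n /=;
    rewrite geq_max => /andP[/hN /= h n0].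
  - by rewrite -type_term_le.
  - by rewrite lee_fin type_term_le.
have mono x y : 0 <= x -> x <= y -> x `^ (1 / k) <= y `^ (1 / k).
  move=> x0 xy; apply: ge0_ler_powR => //; rewrite ?nnegrE ?(ltW k10)//.
  exact: le_trans xy.
have A0 c : 0 < c -> 0 < c `^ k / (expR 1 * k).
  by move=> c0; rewrite divr_gt0// powR_gt0.
apply/eqP; rewrite eq_le; apply/andP; split; apply: ereal_le_pos.
- by apply: limn_esup_ge_near; apply: nearW => n; rewrite lee_fin mulr_ge0 ?powR_ge0.
- move=> c c0 /limn_esup_lt_near hc.
  have {hc}/hterm-/(_ c0) hc : \forall n \near \oo,
      ((n%:R `^ (1 / k) * `|a n| `^ (1 / n%:R))%:E <= c%:E)%E.
    by apply: filterS hc => n /ltW.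
  have : (s <= (c `^ k / (expR 1 * k))%:E)%E.
    apply/lee_addgt0Pr => e e0; apply: ereal_inf_lbound.
    exists (c `^ k / (expR 1 * k) + e) => //; split; first by rewrite addr_gt0 ?A0.
    by rewrite fk; apply: growth_of_coef_bound hc; rewrite ?A0// ltrDl.
  have := growth_type_ge0; rewrite -/s.
  case: s => [s| |]//; rewrite lee_fin => s0; rewrite lee_fin => sc.
  rewrite -(cK c c0) -EFinM poweR_EFin lee_fin.
  by apply: mono; [exact: mulr_ge0 s0 (ltW ek0)|rewrite -ler_pdivlMr].
- exact: poweR_ge0.
- move=> c c0 hc; apply: limn_esup_le_near; apply/hterm => //.
  have : (s < (c `^ k / (expR 1 * k))%:E)%E.
    move: hc; have := growth_type_ge0; rewrite -/s.
    case: s => [s| |]//; rewrite ?lee_fin => s0; last first.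
      (* An infinite type would make the left side infinite, against [hc]. *)
      by rewrite gt0_mulye ?lte_fin// poweRyr// gt_eqF.
    rewrite -EFinM poweR_EFin !lte_fin ltr_pdivlMr// => hc.
    rewrite ltNge; apply/negP => h; move: hc; apply/negP; rewrite -leNgt.
    by rewrite -[leLHS](cK c c0) mono// powR_ge0.
  (* Strict inequality yields an admissible [A] below c^k / (e k), and enlarging the factor in the
     exponent preserves the growth bound. *)
  move=> /ereal_inf_lt[_ [A [Apos hA] <-]]; rewrite lte_fin => Ac.
  apply: (coef_bound_of_growth hser (A0 _ c0) k0).
  near=> r; apply: (@lt_le_trans _ _ (expR (A * r `^ k))%:E).
    by near: r; move: hA; rewrite fk.
  by rewrite lee_fin ler_expR ler_wpM2r ?powR_ge0// ltW.
Unshelve. all: by end_near.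
Qed.

End GrowthFormulas.

Unset Implicit Arguments.

Theorem theorem5p1p9 (R : realType)
    (f : quaternion R -> quaternion R) (a : nat -> quaternion R)
    (rho sigma : \bar R)
    (hreg : slice_regular setT f)
    (hser : forall q : quaternion R,
      series (fun n => q ^+ n * a n) @ \oo --> f q)
    (hrho : growth_order f = rho)
    (hsigma : growth_type f = sigma) :
  rho = limn_esup (fun n => (if a n == 0 then 0
          else n%:R * ln n%:R / ln (1 / `|a n|))%:E) /\
  ((0 < rho < +oo)%E ->
   poweR (sigma * (expR 1 * fine rho)%:E)%E (1 / fine rho) =
   limn_esup (fun n => (n%:R `^ (1 / fine rho) * `|a n| `^ (1 / n%:R))%:E)).
Proof.
subst rho sigma; split; first exact: growth_order_limn_esup.
case E : (growth_order f) => [k| |] /andP[k0 kfin]; last 2 first.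
- by rewrite ltxx in kfin.
- by rewrite ltNge leNye in k0.
by apply: growth_type_limn_esup.
Qed.
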